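(* Let $N\ge2$ be a power of $2$, let $t_1,\dots,t_{\log_2N}$ be the ADDs returned by $\mathrm{makeADDs}$, and let $Y$ be the random trace returned by an invocation of $\mathsf{drawSample}(t_1,\dots,t_{\log_2N})$ (as described in the context). Then for every trace $\omega\in\Omega_N$, $\Pr[Y=\omega]=\frac{1}{|\Omega_N|}$.
   Context: A transition system has $k$ Boolean state variables, state set $S=\{0,1\}^k$, input alphabet $\Sigma=\{0,1\}^m$, transition function $t:S\times\Sigma\to S$, initial states $I\subseteq S$ and target states $F\subseteq S$ (with $0/1$ characteristic functions $I$ and $f$). Its transition relation is $\hat t(s,s')=1$ iff $t(s,a)=s'$ for some $a\in\Sigma$, and $0$ otherwise. A trace of length $N$ is a sequence of states $\omega[0],\dots,\omega[N]$ with $\omega[0]\in I$, $\omega[N]\in F$ and $\hat t(\omega[j],\omega[j+1])=1$ for all $j<N$; $\Omega_N$ is the set of such traces. We use copies $X^0,\dots,X^{\log_2N+1}$ of the state variables. Functions from Boolean assignments to reals are represented as Algebraic Decision Diagrams (ADDs: reduced ordered rooted DAGs, internal nodes labeled by variables in a fixed order along every path with outgoing edges labeled $0,1$, leaves carrying real values). $\times$ is pointwise product; $\sum_{X^i}h$ sums $h$ over all assignments to $X^i$. $\mathrm{makeADDs}(\hat t,N,f,I)$: $g\leftarrow\hat t$ (a function of $X^0,X^1$); for $i=1,\dots,\log_2N$: $t_i(X^0,X^i,X^{i+1})\leftarrow g(X^0,X^i)\times g(X^i,X^{i+1})$, $g\leftarrow\sum_{X^i}t_i$; finally $t_{\log_2N}\leftarrow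 t_{\log_2N}\times f(X^{\log_2N+1})\times I(X^0)$. It returns $t_1,\dots,t_{\log_2N}$. Sampling an assignment from an ADD $\hat t$: order its variables $v_1<\dots<v_n$; the level of an internal node is the index of its variable, and leaves have level $n+1$; for a node $u$, $W(u)$ is the number of assignments to the variables of level in $[\mathrm{level}(\mathrm{root}),\mathrm{level}(u))$ whose evaluation path from the root reaches $u$. Choose a leaf $\ell$ with probability proportional to $\mathrm{val}(\ell)W(\ell)$; then, while the current node $v$ is not the root, choose a parent $p$ of $v$ with probability proportional to $2^{\gamma}W(p)$, where $\gamma$ is the number of variables strictly between $p$'s variable and level$(v)$; set $p$'s variable to the label of the edge $p\to v$, set each skipped variable to an independent uniform random bit, and move to $p$. All random choices are independent. $\mathrm{sampleFromADD}(i,t_i,lo,hi,\omega)$, with $mid=(lo+hi)/2$: if $i=\log_2N$, sample an assignment from $t_{\log_2N}$ and set $\omega[lo],\omega[mid],\omega[hi]$ to the values of $X^0,X^{\log_2N},X^{\log_2N+1}$; otherwise substitute $\omega[lo]$ for $X^0$ and $\omega[hi]$ for $X^{i+1}$ in $t_i$, sample an assignment of the resulting ADD, and set $\omega[mid]$ to the value of $X^i$. $\mathsf{drawSample}$: call $\mathrm{sampleFromADD}(\log_2N,t_{\log_2N},0,N,\omega)$ to obtain $\omega[0],\omega[N/2],\omega[N]$, then call $\mathsf{rec}(\log_2N-1,0,N/2)$ and $\mathsf{rec}(\log_2N-1,N/2,N)$, where $\mathsf{rec}(i,lo,hi)$ (for $i\ge1$; it does nothing when $i=0$) sets $mid=(lo+hi)/2$,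 calls $\mathrm{sampleFromADD}(i,t_i,lo,hi,\omega)$ to obtain $\omega[mid]$, and then calls $\mathsf{rec}(i-1,lo,mid)$ and $\mathsf{rec}(i-1,mid,hi)$. It returns $\omega=(\omega[0],\dots,\omega[N])$.
   Formalization: When sampling from an ADD, variables that precede the root's variable (all variables, if the ADD is constant) are also set to independent uniform random bits; the walk as described stops at the root and leaves them unset. *)

(* Defs.v *)
From HB Require Import structures.
From mathcomp Require Import all_boot all_order all_algebra reals.

Set Implicit Arguments.
Unset Strict Implicit.
Unset Printing Implicit Defensive.

Import Order.TTheory GRing.Theory Num.Theory.
Local Open Scope ring_scope.

(* Mass functions on a finite type.  Successive binds are independent draws. *)
Section Dist.
Context {R : realType}.

Definition dist (T : finType) := {ffun T -> R}.

Definition dret (T : finType) (x : T) : dist T := [ffun y => (y == x)%:R].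

Definition dbind (T U : finType) (d : dist T) (f : T -> dist U) : dist U :=
  [ffun u => \sum_x d x * f x u].

(* A random element, with probability proportional to w.  If the weights sum
   to 0 there is no such draw, and the result is the zero mass function. *)
Definition dpick (T : finType) (w : T -> R) : dist T :=
  [ffun x => w x / \sum_y w y].

Definition dcoin : dist bool := dpick (fun _ => 1).

End Dist.

Inductive content (R V N : Type) : Type :=
| Leaf of R
| Branch of V & N & N. (* variable, 0-successor, 1-successor *)
Arguments Leaf {R V N} _.
Arguments Branch {R V N} _ _ _.

Section ADD.
Context {R : realType} {V : finType}.

(* Assignments.  An assignment to the variables of a subset D of V is
   represented by a function that is false outside D. *)
Definition asg := {ffun V -> bool}.

Definition setv (x : asg) (v : V) (b : bool) : asg :=
  [ffun w => if w == v then b else x w].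

Record dag := Dag {
  vars : {set V};
  node : finType;
  droot : node;
  nodeE : node -> content R V node }.

Definition edge (A : dag) : rel (node A) := fun u u' =>
  if nodeE u is Branch _ n0 n1 then (u' == n0) || (u' == n1) else false.

Definition step (A : dag) (x : asg) (u : node A) : node A :=
  if nodeE u is Branch v n0 n1 then (if x v then n1 else n0) else u.

Definition reaches (A : dag) (x : asg) (u : node A) : bool :=
  fconnect (step x) (droot A) u.

(* In an ordered diagram an evaluation path has at most #|vars A| edges. *)
Definition eval (A : dag) (x : asg) : R :=
  if nodeE (iter #|vars A| (step x) (droot A)) is Leaf r then r else 0.

Variable le : rel V. (* the variable order *)

Definition ordvars (D : {set V}) : seq V := sort le (enum D).

(* Levels are numbered from 0: the variables have levels 0, .., n-1, the
   leaves have level n.  Only differences and comparisons of levels matter. *)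
Definition vlevel (D : {set V}) (v : V) : nat := index v (ordvars D).

Definition level (A : dag) (u : node A) : nat :=
  if nodeE u is Branch v _ _ then vlevel (vars A) v else #|vars A|.

(* Injectivity of nodeE says that no two nodes carry the same leaf value, and
   that no two nodes have the same variable and the same successors. *)
Definition is_add (A : dag) : Prop :=
  [/\ forall (u : node A) v n0 n1, nodeE u = Branch v n0 n1 ->
        [/\ v \in vars A, (level u < level n0)%N & (level u < level n1)%N],
      forall (u : node A) v n0 n1, nodeE u = Branch v n0 n1 -> n0 <> n1,
      injective (@nodeE A)
    & forall u : node A, connect (@edge A) (droot A) u].

Record add := Add { dag_of :> dag; addP : is_add dag_of }.

Section Sample.
Variable A : dag.

Definition W (u : node A) : nat :=
  #|[set x : asg | (false.-support x \subset
        [set v in vars A | (level (droot A) <= vlevel (vars A) v < level u)%N])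
      & reaches x u]|.

Definition leaf_weight (u : node A) : R :=
  if nodeE u is Leaf r then r * (W u)%:R else 0.

Definition parent_weight (u p : node A) : R :=
  if edge p u then 2 ^+ (level u - level p).-1 * (W p)%:R else 0.

(* An independent uniform random bit for each variable in the list. *)
Fixpoint randomize (s : seq V) (x : asg) : @dist R asg :=
  if s is v :: s' then
    dbind dcoin (fun b => randomize s' (setv x v b))
  else dret x.

Definition between (u u' : node A) : seq V :=
  [seq v <- ordvars (vars A) |
     (level u < vlevel (vars A) v < level u')%N].

(* The walk to the root.  Levels decrease, so fuel #|vars A| suffices. *)
Fixpoint climb (fuel : nat) (u : node A) (x : asg) : @dist R asg :=
  if u == droot A then dret x else
  if fuel is fuel'.+1 then
    dbind (dpick (parent_weight u)) (fun p =>
      if nodeE p is Branch v n0 n1 then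
        dbind (randomize (between p u) (setv x v (n1 == u))) (climb fuel' p)
      else dret x)
  else dret x.

(* The variables before the root's variable are skipped on every path, hence
   they receive random bits too. *)
Definition above_root : seq V :=
  [seq v <- ordvars (vars A) | (vlevel (vars A) v < level (droot A))%N].

Definition sampleADD : @dist R asg :=
  dbind (dpick leaf_weight) (fun l =>
    dbind (climb #|vars A| l [ffun=> false]) (randomize above_root)).

End Sample.

(* An implementation of ADDs: mk D h is a reduced ordered ADD over the
   variables D for the function h, if h depends only on D. *)
Record add_package := AddPackage {
  mk : {set V} -> (asg -> R) -> add;
  mk_vars : forall D h, vars (mk D h) = D;
  mk_eval : forall (D : {set V}) (h : asg -> R),
    (forall x y : asg, {in D, x =1 y} -> h x = h y) ->
    forall x, eval (mk D h) x = h x }.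

End ADD.
Arguments asg : clear implicits.
Arguments dag : clear implicits.
Arguments add R {V} le.
Arguments add_package R {V} le.

Definition bits (k : nat) := {ffun 'I_k -> bool}.

Record tsystem (k m : nat) := TSystem {
  trans : bits k -> bits m -> bits k;
  init : {set bits k};
  target : {set bits k} }.

Definition trel k m (M : tsystem k m) (s s' : bits k) : bool :=
  [exists a, trans M s a == s'].

(* Sequences of states w[0], .., w[N]. *)
Definition tseq (k N : nat) := {ffun 'I_N.+1 -> bits k}.

Definition get k N (w : tseq k N) (j : nat) : bits k := w (inord j).

Definition put k N (j : nat) (s : bits k) (w : tseq k N) : tseq k N :=
  [ffun i => if i == inord j then s else w i].

Definition Omega k m (M : tsystem k m) (N : nat) : {set tseq k N} :=
  [set w | [&& get w 0 \in init M, get w N \in target M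
             & [forall j : 'I_N, trel M (get w j) (get w j.+1)]]].

(* Bit j of the copy X^c of the state variables, for c = 0, .., n + 1, where
   n = log_2 N. *)
Definition xvar (k n : nat) : finType := ('I_n.+2 * 'I_k)%type.

Section Sampler.
Context {R : realType} {k m n : nat} {le : rel (xvar k n)}.
Variables (P : add_package R le) (M : tsystem k m).
Implicit Types (A B : add R le) (x : asg (xvar k n)) (s : bits k).

Definition X (c : nat) : {set xvar k n} := [set v | v.1 == inord c].

Definition getX (c : nat) x : bits k := [ffun j => x (inord c, j)].

Definition setX (c : nat) s x : asg (xvar k n) :=
  [ffun v => if v.1 == inord c then s v.2 else x v].

Definition add_mul A B : add R le :=
  mk P (vars A :|: vars B) (fun x => eval A x * eval B x).

Definition add_sum (c : nat) A : add R le :=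
  mk P (vars A :\: X c) (fun x => \sum_s eval A (setX c s x)).

Definition add_subst (c : nat) s A : add R le :=
  mk P (vars A :\: X c) (fun x => eval A (setX c s x)).

(* g(X^0, X^i) |-> g(X^i, X^{i+1}) *)
Definition add_shift (i : nat) A : add R le :=
  mk P (X i :|: X i.+1)
    (fun x => eval A (setX 0 (getX i x) (setX i (getX i.+1 x) x))).

Definition add_trans : add R le :=
  mk P (X 0 :|: X 1) (fun x => (trel M (getX 0 x) (getX 1 x))%:R).

Definition add_target (c : nat) : add R le :=
  mk P (X c) (fun x => (getX c x \in target M)%:R).

Definition add_init (c : nat) : add R le :=
  mk P (X c) (fun x => (getX c x \in init M)%:R).

(* t_i, from the value of g at the start of iteration i. *)
Definition iter_t (i : nat) (g : add R le) : add R le :=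
  add_mul g (add_shift i g).

(* The value of g after i iterations. *)
Fixpoint iter_g (i : nat) : add R le :=
  if i is j.+1 then add_sum i (iter_t i (iter_g j)) else add_trans.

(* makeADDs i is t_i, for i = 1, .., n. *)
Definition makeADDs (i : nat) : add R le :=
  let ti := iter_t i (iter_g i.-1) in
  if i == n then add_mul (add_mul ti (add_target n.+1)) (add_init 0) else ti.

Variables (N : nat) (t : nat -> add R le).

Definition sampleFromADD (i : nat) (A : add R le) (lo hi : nat)
    (w : tseq k N) : @dist R (tseq k N) :=
  let mid := ((lo + hi) %/ 2)%N in
  if i == n then
    dbind (sampleADD le A) (fun x =>
      dret (put hi (getX n.+1 x) (put mid (getX n x) (put lo (getX 0 x) w))))
  else
    dbind (sampleADD le (add_subst i.+1 (get w hi) (add_subst 0 (get w lo) A)))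
      (fun x => dret (put mid (getX i x) w)).

Fixpoint rec (i lo hi : nat) (w : tseq k N) : @dist R (tseq k N) :=
  if i is j.+1 then
    let mid := ((lo + hi) %/ 2)%N in
    dbind (sampleFromADD i (t i) lo hi w) (fun w1 =>
      dbind (rec j lo mid w1) (rec j mid hi))
  else dret w.

(* The initial content of the array is immaterial: every entry is set. *)
Definition drawSample : @dist R (tseq k N) :=
  dbind (sampleFromADD n (t n) 0 N [ffun=> [ffun=> false]]) (fun w =>
    dbind (rec n.-1 0 (N %/ 2) w) (rec n.-1 (N %/ 2) N)).

End Sampler.

(* ADD packages exist: the nodes are the restrictions of the function, a node
   being labelled by the first variable on which it depends; then the nodes
   that the root does not reach are removed. *)
Section Existence.
Context {R : realType} {V : finType}.
Variable le : rel V.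

Section Trim.
Variable A : dag R V.
Hypothesis A_ord : forall (u : node A) v n0 n1, nodeE u = Branch v n0 n1 ->
  [/\ v \in vars A, (level le u < level le n0)%N
                  & (level le u < level le n1)%N].

Definition tnode : finType := {u : node A | connect (@edge _ _ A) (droot A) u}.
Definition troot : tnode := Sub (droot A) (connect0 _ _).
Definition tnodeE (u : tnode) : content R V tnode :=
  match nodeE (val u) with
  | Leaf r => Leaf r
  | Branch v n0 n1 => Branch v (insubd troot n0) (insubd troot n1)
  end.
Definition trim : dag R V := @Dag R V (vars A) tnode troot tnodeE.

Lemma val_succ (u : tnode) (n : node A) :
  edge (val u) n -> val (insubd troot n) = n.
Proof.
move=> e; rewrite val_insubd.
by rewrite (connect_trans (valP u) (connect1 e)).
Qed.

Lemma nodeE_trim (u : tnode) :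
  match nodeE (val u) with
  | Leaf r => tnodeE u = Leaf r
  | Branch v n0 n1 => exists t0 t1,
      [/\ tnodeE u = Branch v t0 t1, val t0 = n0 & val t1 = n1]
  end.
Proof.
rewrite /tnodeE; case E: (nodeE (val u)) => [r|v n0 n1] //.
exists (insubd troot n0), (insubd troot n1); split => //.
- by apply: (@val_succ u); rewrite /edge E eqxx.
- by apply: (@val_succ u); rewrite /edge E eqxx orbT.
Qed.

Lemma level_trim (u : node trim) : level le u = level le (val u).
Proof.
by rewrite /level /= /tnodeE; case: (nodeE _).
Qed.

Lemma next_trim x (u : node trim) : val (step x u) = step x (val u).
Proof.
rewrite /step /=; have := nodeE_trim u.
case: (nodeE (val u)) => [r ->|v n0 n1 [t0 [t1 [-> <- <-]]]] //.
by case: (x v).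
Qed.

Lemma iter_trim x j (u : node trim) :
  val (iter j (step x) u) = iter j (step x) (val u).
Proof. by elim: j => // j IH; rewrite !iterS -IH; apply: next_trim. Qed.

Lemma eval_trim x : eval trim x = eval A x.
Proof.
rewrite /eval /=; have := nodeE_trim (iter #|vars A| (step x) (droot trim)).
rewrite iter_trim /=.
by case: (nodeE _) => [r ->|v n0 n1 [t0 [t1 [-> _ _]]]].
Qed.

Lemma trim_is_add :
  (forall (u : node A) v n0 n1, nodeE u = Branch v n0 n1 -> n0 <> n1) ->
  injective (@nodeE _ _ A) -> is_add le trim.
Proof.
move=> red inj; split.
- move=> u v t0 t1; rewrite !level_trim -[nodeE u]/(tnodeE u).
  have := nodeE_trim u.
  case E: (nodeE (val u)) => [r|w n0 n1]; first by move=> ->.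
  case=> s0 [s1 [-> e0 e1]].
  by case=> <- <- <-; rewrite e0 e1; apply: A_ord.
- move=> u v t0 t1; rewrite -[nodeE u]/(tnodeE u); have := nodeE_trim u.
  case E: (nodeE (val u)) => [r|w n0 n1]; first by move=> ->.
  case=> s0 [s1 [-> e0 e1]].
  case=> _ <- <- e; apply: (red _ _ _ _ E).
  by rewrite -e0 -e1 e.
- move=> u u' e; apply: val_inj; apply: inj; have := nodeE_trim u.
  rewrite -[tnodeE u]/(nodeE (u : node trim)) e; have := nodeE_trim u'.
  rewrite -[tnodeE u']/(nodeE (u' : node trim)).
  case: (nodeE (val u')) => [r ->|w n0 n1 [s0 [s1 [-> e0 e1]]]];
  case: (nodeE (val u)) => [r' |w' n0' n1'] //.
  + by case=> ->.
  + by case=> t0 [t1 []].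
  + by case=> t0 [t1 [[ew es0 es1] <- <-]]; rewrite -es0 -es1 e0 e1 ew.
- suff H (u : node A) : connect (@edge _ _ A) (droot A) u ->
      exists2 t : tnode, val t = u & connect (@edge _ _ trim) troot t.
    by move=> u; have [t /val_inj -> //] := H _ (valP u).
  case/connectP=> p; elim/last_ind: p u => [|p u' IH] u.
    by move=> _ ->; exists troot => //; exact: connect0.
  rewrite rcons_path last_rcons => /andP [pth e] -> {u}.
  have [t et ct] := IH _ pth erefl.
  rewrite -et in e; exists (insubd troot u'); first exact: val_succ e.
  apply: (connect_trans ct); apply: connect1.
  move: e; rewrite /edge /= /tnodeE; case: (nodeE _) => // v n0 n1.
  by case/orP=> /eqP ->; rewrite eqxx ?orbT.
Qed.

End Trim.

Section Cofactors.
Variables (D : {set V}) (h : asg V -> R).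

Definition hD : {ffun asg V -> R} :=
  [ffun x : asg V => h [ffun v => (v \in D) && x v]].

(* Restriction of hD by the values of y on S. *)
Definition cof (p : {set V} * asg V) : {ffun asg V -> R} :=
  [ffun x : asg V => hD [ffun v => if v \in p.1 then p.2 v else x v]].

Definition cofs : seq {ffun asg V -> R} := codom cof.
Definition cnode : finType := seq_sub cofs.

Lemma cof_set_subproof (u : cnode) v b :
  [ffun x : asg V => ssval u (setv x v b)] \in cofs.
Proof.
case: u => phi /= /codomP [[S y] ->]; apply/codomP.
exists (v |: S, if v \in S then y else setv y v b).
apply/ffunP=> x; rewrite !ffunE; congr (h _); apply/ffunP=> w.
rewrite !ffunE !inE; congr (_ && _).
have [->|ne] := eqVneq w v => /=.
  by case: ifP => // _; rewrite ffunE eqxx.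
by case: ifP => // wS; case: ifP => // _; rewrite ffunE (negbTE ne).
Qed.

Definition cset (u : cnode) v b : cnode := SeqSub (cof_set_subproof u v b).

Lemma cof_root_subproof : hD \in cofs.
Proof.
apply/codomP; exists (set0, [ffun=> false]); apply/ffunP=> x.
by rewrite !ffunE; congr (h _); apply/ffunP=> v; rewrite !ffunE inE.
Qed.

Definition depends (u : cnode) (v : V) : bool :=
  [exists x, ssval u (setv x v false) != ssval u (setv x v true)].

Definition cnodeE (u : cnode) : content R V cnode :=
  if [seq v <- ordvars le D | depends u v] is v :: _
  then Branch v (cset u v false) (cset u v true)
  else Leaf (ssval u [ffun=> false]).

Definition cdag : dag R V := @Dag R V D cnode (SeqSub cof_root_subproof) cnodeE.

Lemma setv_id (x : asg V) v : setv x v (x v) = x.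
Proof. by apply/ffunP=> w; rewrite ffunE; case: eqP => [->|]. Qed.

Lemma setv_setv (x : asg V) v b b' : setv (setv x v b) v b' = setv x v b'.
Proof. by apply/ffunP=> w; rewrite !ffunE; case: eqP. Qed.

Lemma setvC (x : asg V) v w b c : v != w ->
  setv (setv x v b) w c = setv (setv x w c) v b.
Proof.
move=> ne; apply/ffunP=> z; rewrite !ffunE.
by have [->|] := eqVneq z w; rewrite // eq_sym (negbTE ne).
Qed.

Lemma ndep (u : cnode) v x b : ~~ depends u v -> ssval u (setv x v b) = ssval u x.
Proof.
rewrite negb_exists => /forallP /(_ x); rewrite negbK => /eqP e.
rewrite -[in RHS](setv_id x v).
by case: b; case: (x v).
Qed.

Lemma ndep_notin (u : cnode) v : v \notin D -> ~~ depends u v.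
Proof.
move=> vD; rewrite negb_exists; apply/forallP=> x; rewrite negbK; apply/eqP.
case: u => phi /= /codomP [[S y] ->]; rewrite !ffunE; congr (h _).
apply/ffunP=> w; rewrite !ffunE /=; have [->|//] := eqVneq w v.
by rewrite (negbTE vD).
Qed.

Lemma dep_cset (u : cnode) v b w : depends (cset u v b) w -> (w != v) && depends u w.
Proof.
case/existsP=> x; rewrite !ffunE.
have [->|ne] := eqVneq w v; first by rewrite !setv_setv eqxx.
by rewrite !(setvC _ _ _ ne) => H; apply/existsP; exists (setv x v b).
Qed.

Lemma ndep_const (u : cnode) x :
  (forall v, ~~ depends u v) -> ssval u x = ssval u [ffun=> false].
Proof.
move=> nd.
suff H (s : seq V) : ssval u x = ssval u [ffun v => (v \notin s) && x v].
  rewrite (H (enum V)); congr (ssval u _); apply/ffunP=> v.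
  by rewrite !ffunE mem_enum.
elim: s => [|v s IH]; first by congr (ssval u _); apply/ffunP=> w; rewrite ffunE.
rewrite IH -(ndep [ffun w => (w \notin s) && x w] false (nd v)).
congr (ssval u _); apply/ffunP=> w; rewrite !ffunE inE negb_or.
by case: eqP.
Qed.

Lemma mem_ordvars v : (v \in ordvars le D) = (v \in D).
Proof. by rewrite mem_sort mem_enum. Qed.

Lemma size_ordvars : size (ordvars le D) = #|D|.
Proof. by rewrite size_sort cardE. Qed.

Lemma vlevel_lt v : v \in D -> (vlevel le D v < #|D|)%N.
Proof. by rewrite -mem_ordvars -index_mem size_ordvars. Qed.

Lemma filter_head (s : seq V) (a : pred V) v s' :
  [seq w <- s | a w] = v :: s' ->
  [/\ a v, v \in s & forall w, w \in s -> a w -> (index v s <= index w s)%N].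
Proof.
elim: s => //= z s IH; case: ifP => az.
  by case=> <- _; split; rewrite ?mem_head // => w; rewrite eqxx.
case/IH=> av vs H; split; rewrite ?in_cons ?vs ?orbT // => w.
rewrite in_cons => /orP [/eqP ->|ws aw]; first by rewrite az.
case: (z =P v) => // _; case: eqP => [ez|_]; last by rewrite ltnS; apply: H.
by move: az; rewrite ez aw.
Qed.

Lemma cnodeEP (u : cnode) :
  match cnodeE u with
  | Leaf r => r = ssval u [ffun=> false] /\ forall v, ~~ depends u v
  | Branch v n0 n1 => [/\ n0 = cset u v false, n1 = cset u v true, depends u v,
      v \in D & forall w, w \in D -> depends u w -> (vlevel le D v <= vlevel le D w)%N]
  end.
Proof.
rewrite /cnodeE; case E: [seq _ <- _ | _] => [|v s]; last first.
  have [dv vs H] := filter_head E; rewrite mem_ordvars in vs.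
  by split => // w wD; apply: H; rewrite mem_ordvars.
split=> // v; have [vD|/ndep_notin //] := boolP (v \in D).
apply/negP=> dv.
suff : v \in [seq v <- ordvars le D | depends u v] by rewrite E.
by rewrite mem_filter dv mem_ordvars.
Qed.

Lemma cdag_level (u : node cdag) v n : v \in D ->
  (forall w, depends n w -> (w != v) && depends u w) ->
  (forall w, w \in D -> depends u w -> (vlevel le D v <= vlevel le D w)%N) ->
  (vlevel le D v < level le (n : node cdag))%N.
Proof.
move=> vD H Hv; rewrite /level /=; have := cnodeEP n.
case: (cnodeE n) => [r _|w n0 n1 [_ _ dw wD _]]; first exact: vlevel_lt.
have /andP [ne duw] := H _ dw.
rewrite ltn_neqAle (Hv _ wD duw) andbT; apply: contra ne => /eqP e.
rewrite -(nth_index v (s := ordvars le D) (x := w)) ?mem_ordvars //.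
by rewrite -[index w _]/(vlevel le D w) -e nth_index ?mem_ordvars.
Qed.

Lemma cdag_ord (u : node cdag) v n0 n1 : nodeE u = Branch v n0 n1 ->
  [/\ v \in vars cdag, (level le u < level le n0)%N
                    & (level le u < level le n1)%N].
Proof.
move=> /= E; have := cnodeEP u; rewrite E => -[e0 e1 dv vD Hv].
have -> : level le u = vlevel le D v by rewrite /level /= E.
by split=> //; apply: (@cdag_level u) => // w; rewrite ?e0 ?e1; apply: dep_cset.
Qed.

Lemma cdag_red (u : node cdag) v n0 n1 : nodeE u = Branch v n0 n1 -> n0 <> n1.
Proof.
move=> /= E; have := cnodeEP u; rewrite E => -[-> -> /existsP [x nx] _ _] e.
move: nx; have /(congr1 (fun f : {ffun asg V -> R} => f x)) := congr1 val e.
by rewrite !ffunE => ->; rewrite eqxx.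
Qed.

Lemma cdag_inj : injective (@nodeE _ _ cdag).
Proof.
move=> u u' /= e; apply: val_inj; apply/ffunP => x /=.
have := cnodeEP u; have := cnodeEP u'; rewrite e.
case: (cnodeE u') => [r [-> nd'] [er nd]|v n0 n1 [e0 e1 _ _ _] [e0' e1' _ _ _]].
  by rewrite (ndep_const _ nd) (ndep_const _ nd') er.
rewrite -(setv_id x v); case: (x v).
  have /(congr1 (fun f : {ffun asg V -> R} => f x)) := congr1 val (etrans (esym e1) e1').
  by rewrite !ffunE.
have /(congr1 (fun f : {ffun asg V -> R} => f x)) := congr1 val (etrans (esym e0) e0').
by rewrite !ffunE.
Qed.

Lemma cdag_iter x j : ssval (iter j (step x) (droot cdag) : cnode) x = hD x.
Proof.
elim: j => [|j IH] //; rewrite iterS -IH /step /=.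
set u := iter j _ _; have := cnodeEP u.
case: (cnodeE u) => // v n0 n1 [-> -> _ _ _].
by case xv: (x v) => /=; rewrite ffunE -xv setv_id.
Qed.

Lemma cdag_iter_level x j :
  (if nodeE (iter j (step x) (droot cdag)) is Branch _ _ _ then
    (j <= level le (iter j (step x) (droot cdag)))%N else true).
Proof.
elim: j => [|j IH]; first by case: nodeE.
rewrite iterS; move: IH; set u := iter j _ _; rewrite /step.
case E: (nodeE u) => [r|v n0 n1] IH; first by rewrite E.
have [_ l0 l1] := cdag_ord E.
by case: (x v); case: nodeE => // *; apply: leq_ltn_trans IH _.
Qed.

Lemma eval_cdag x : eval cdag x = hD x.
Proof.
rewrite /eval; have := cdag_iter_level x #|vars cdag|.
have := cdag_iter x #|vars cdag|.
set u := iter _ _ _ => <-; have := cnodeEP u; rewrite /level /=.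
case: (cnodeE u) => [r [-> nd] _|v n0 n1 [_ _ _ vD _]].
  by rewrite (@ndep_const u x nd).
move=> H; exfalso; move: H.
by rewrite leqNgt vlevel_lt.
Qed.

Definition add_of : add R le :=
  Add (trim_is_add cdag_ord cdag_red cdag_inj).

Lemma eval_add_of x :
  (forall x y : asg V, {in D, x =1 y} -> h x = h y) -> eval add_of x = h x.
Proof.
move=> hP; rewrite /= eval_trim eval_cdag ffunE; apply: hP => v vD.
by rewrite ffunE vD.
Qed.

End Cofactors.

Lemma add_package_exists : inhabited (add_package R le).
Proof.
split; apply: (@AddPackage _ _ _ add_of) => [//|D h hP x].
exact: eval_add_of.
Qed.
End Existence.

(* Main.v *)
Require Import Defs.
From mathcomp Require Import all_boot all_order all_algebra reals.
From mathcomp Require Import zify ring.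

(* Write W(u) for the number of assignments to the variables between the root
   and u whose path reaches u.  A path entering u /= root comes from a unique
   parent p, and the 2^gamma ways of setting the skipped variables give
   W(u) = sum_p 2^gamma W(p).  Hence climbing from u is uniform over these W(u)
   assignments, and a draw from a diagram has probability
   eval(x) / sum_y eval(y).
   The leaf_value of t_i at (a, b, c) is the number of paths of length 2^i from a to c
   with middle state b.  A draw of the middle state therefore costs the factor
   #(a,b) #(b,c) / #(a,c), and these factors telescope along the recursion to
   1 / |Omega_N|.
   Products of draws, and sums over assignments or state sequences, are split
   by the relation "x and y agree outside S", which composes over disjoint
   sets S. *)

Set Implicit Arguments.
Unset Strict Implicit.
Unset Printing Implicit Defensive.

Import Order.TTheory GRing.Theory Num.Theory.
Local Open Scope ring_scope.

(** * Functions that differ only on a given set, and sums over them *)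

Section Agreement.
Context {I T : finType}.
Implicit Types (S : {set I}) (x y z : {ffun I -> T}).

(** Read as a transition: [y] arises from [x] by rewriting coordinates in [S] only. Up to a
    constant, its indicator is the law of a uniform rewriting of [S]. *)
Definition agree_off S x y : bool := [forall i, (i \notin S) ==> (x i == y i)].

Definition mix S x y : {ffun I -> T} := [ffun i => if i \in S then x i else y i].

Lemma agree_offP S x y :
  reflect (forall i, i \notin S -> x i = y i) (agree_off S x y).
Proof.
apply: (iffP forallP) => [H i iS|H i]; first by have := H i; rewrite iS => /eqP.
by apply/implyP=> iS; rewrite (H i iS).
Qed.

Lemma agree_off0 x y : agree_off set0 x y = (y == x).
Proof.
apply/agree_offP/eqP => [H|-> //]; apply/ffunP=> i.
by rewrite H ?inE.
Qed.

Lemma agree_off_mix S x y : agree_off S x (mix S y x).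
Proof. by apply/agree_offP=> i iS; rewrite ffunE (negbTE iS). Qed.

(** Two successive rewritings on disjoint sets have only one possible intermediate state: off [S1]
    it is still [x], and on [S1] it must already be [y]. The sum collapses to this term. *)
Lemma sum_agree_offU (R : pzSemiRingType) S1 S2 x y (G : {ffun I -> T} -> R) :
  [disjoint S1 & S2] ->
  \sum_z (agree_off S1 x z)%:R * (G z * (agree_off S2 z y)%:R) =
  G (mix S1 y x) * (agree_off (S1 :|: S2) x y)%:R.
Proof.
move=> dis; rewrite (bigD1 (mix S1 y x)) //= agree_off_mix mul1r big1 => [|z nz].
  rewrite addr0; congr (_ * _%:R); congr nat_of_bool.
  apply/agree_offP/agree_offP => H i; rewrite ?inE.
    by rewrite negb_or => /andP [i1 i2]; rewrite -H // ffunE (negbTE i1).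
  move=> i2; rewrite ffunE; case: ifP => // i1; apply: H.
  by rewrite inE i1.
case: agree_offP => H1; last by rewrite mul0r.
case: agree_offP => H2; last by rewrite !mulr0.
case/eqP: nz; apply/ffunP=> i; rewrite ffunE; case: ifP => [i1|/negbT i1].
  by rewrite H2 // (disjointFr dis i1).
by rewrite H1.
Qed.

(** Inserts the unique intermediate state, by the preceding lemma with constant [G], and exchanges
    the sums. *)
Lemma sum_agree_off_split (R : pzSemiRingType) S1 S2 x (F : {ffun I -> T} -> R) :
  [disjoint S1 & S2] ->
  \sum_y (agree_off (S1 :|: S2) x y)%:R * F y =
  \sum_z (agree_off S1 x z)%:R * \sum_y (agree_off S2 z y)%:R * F y.
Proof.
move=> dis; under [RHS]eq_bigr => z _ do rewrite big_distrr /=.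
rewrite exchange_big /=; apply: eq_bigr => y _.
have := @sum_agree_offU R S1 S2 x y (fun=> 1) dis; rewrite mul1r => <-.
by rewrite big_distrl; apply: eq_bigr => z _; rewrite mul1r mulrA.
Qed.

(** The hypothesis says that [F] reads coordinates in [S] only, so replacing the values of [x]
    outside [S] by those of [x'] is a bijection of the summation ranges that preserves [F]. *)
Lemma sum_agree_off_base (R : pzSemiRingType) S x x' (F : {ffun I -> T} -> R) :
  (forall y y', agree_off (~: S) y y' -> F y = F y') ->
  \sum_y (agree_off S x y)%:R * F y = \sum_y (agree_off S x' y)%:R * F y.
Proof.
move=> HF; rewrite [RHS](bigID (agree_off S x')) /= [X in _ + X]big1 => [|y /negbTE ->];
  last by rewrite mul0r.
rewrite [LHS](bigID (agree_off S x)) /= [X in _ + X]big1 => [|y /negbTE ->];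
  last by rewrite mul0r.
rewrite !addr0 (reindex_onto (fun y => mix S y x) (fun y => mix S y x')) /=; last first.
  by move=> y /agree_offP H; apply/ffunP=> i; rewrite !ffunE; case: (boolP (i \in S)) => // iS;
    rewrite H.
apply: eq_big => [y|y].
  rewrite agree_off_mix /=; apply/eqP/agree_offP => [<- i iS|H].
    by rewrite !ffunE (negbTE iS).
  by apply/ffunP=> i; rewrite !ffunE; case: (boolP (i \in S)) => // iS; rewrite H.
rewrite agree_off_mix /= => /eqP <-; rewrite agree_off_mix; congr (_ * _).
by apply: HF; apply/agree_offP=> i; rewrite inE negbK !ffunE => ->.
Qed.

End Agreement.

(** * Counting list entries between two positions *)

Lemma count_iota_between a b n :
  count (fun i => a < i < b)%N (iota 0 n) = (minn b n - a).-1.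
Proof.
elim: n => [|n IH]; first by rewrite minn0.
by rewrite -[in iota 0 _]addn1 iotaD count_cat IH /= add0n; lia.
Qed.

(** Without repetitions, the indices of the entries are exactly [iota 0 (size s)]. This gives the
    number of variables skipped by an edge. *)
Lemma size_filter_index_between (T : eqType) (s : seq T) a b : uniq s ->
  (b <= size s)%N ->
  size [seq v <- s | (a < index v s < b)%N] = (b - a).-1.
Proof.
move=> us bs; rewrite size_filter.
have -> : count (fun v => a < index v s < b)%N s =
          count (fun i => a < i < b)%N (map (index^~ s) s) by rewrite count_map.
have -> : map (index^~ s) s = iota 0 (size s).
  case: s us {bs} => // x0 s us.
  apply: (@eq_from_nth _ 0%N) => [|i]; rewrite size_map ?size_iota // => hi.
  by rewrite (nth_map x0) // nth_iota // index_uniq.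
by rewrite count_iota_between (minn_idPl bs).
Qed.

(** * The law of a draw from a single diagram *)

Section Sampling.
Context {R : realType} {V : finType} (le : rel V).
Variable A : Defs.add R le.
Implicit Types (u p : node A) (x y : asg V).
Local Notation lv := (vlevel le (vars A)).
Local Notation lvl := (@level _ _ le A).
Local Notation root := (droot A).

Lemma vlevel_inj v w : v \in vars A -> lv v = lv w -> v = w.
Proof.
move=> vD e; rewrite -(nth_index v (s := ordvars le (vars A)) (x := v)) ?mem_ordvars //.
rewrite -[index v _]/(lv v) e nth_index // -index_mem -[index w _]/(lv w) -e.
by rewrite index_mem mem_ordvars.
Qed.

Lemma level_le u : (lvl u <= #|vars A|)%N.
Proof.
rewrite /level; case E: (nodeE u) => [//|v n0 n1]; apply: ltnW.
by have [ordA _ _ _] := addP A; have [vD _ _] := ordA _ _ _ _ E; apply: vlevel_lt.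
Qed.

Lemma step_level x u v n0 n1 : nodeE u = Branch v n0 n1 ->
  (lvl u < lvl (step x u))%N.
Proof.
move=> E; rewrite /step E.
have [ordA _ _ _] := addP A; have [_ l0 l1] := ordA _ _ _ _ E.
by case: (x v).
Qed.

Lemma step_level_le x u : (lvl u <= lvl (step x u))%N.
Proof.
case E: (nodeE u) => [r|v n0 n1]; first by rewrite /step E.
exact: ltnW (step_level x E).
Qed.

Lemma iter_step_level_le x u j : (lvl u <= lvl (iter j (step x) u))%N.
Proof. by elim: j => //= j IH; exact: leq_trans IH (step_level_le _ _). Qed.

Lemma reachesP x u :
  reflect (exists j, iter j (step x) root = u) (reaches x u).
Proof.
apply: (iffP idP) => [|[j <-]]; last exact: fconnect_iter.
by move=> /iter_findex <-; exists (findex (step x) root u).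
Qed.

Lemma reaches_level x u : reaches x u -> (lvl root <= lvl u)%N.
Proof. by case/reachesP=> j <-; apply: iter_step_level_le. Qed.

(** The variables over which [W] counts; whether a path reaches [u] depends on them alone. *)
Definition path_vars u : {set V} :=
  [set v in vars A | (lvl root <= lv v < lvl u)%N].

(** Every variable read before [u] has a level between those of the root and [u], where [x] and [y]
    agree; so both take the same branches. *)
Lemma agree_reaches u x y : agree_off (~: path_vars u) x y -> reaches x u -> reaches y u.
Proof.
move=> /agree_offP H /reachesP [j]; elim: j u H => [|j IH] u H /=.
  by move=> <-; apply/reachesP; exists 0%N.
set u' := iter j _ _ => e.
case E: (nodeE u') => [r|v n0 n1].
  by move: e; rewrite /step E => e; apply: IH.
have lu : (lvl u' < lvl u)%N by rewrite -e (step_level x E).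
have ry : reaches y u'.
  apply: IH => // w; rewrite !inE negbK => /and3P [wD w1 w2]; apply: H.
  by rewrite !inE negbK wD w1 (ltn_trans w2 lu).
have vx : x v = y v.
  apply: H; have [ordA _ _ _] := addP A; have [vD _ _] := ordA _ _ _ _ E.
  have ev : lv v = lvl u' by rewrite /level E.
  by rewrite !inE negbK vD ev lu (reaches_level ry).
case/reachesP: ry => i ei; apply/reachesP; exists i.+1.
by rewrite /= ei -e /step E vx.
Qed.

Lemma agree_offC (S : {set V}) x y : agree_off S x y = agree_off S y x.
Proof. by apply/agree_offP/agree_offP => H i iS; rewrite H. Qed.

Lemma reaches_agree u x y :
  agree_off (~: path_vars u) x y -> reaches x u = reaches y u.
Proof.
move=> H; apply/idP/idP; apply: agree_reaches => //.
by rewrite agree_offC.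
Qed.

(** [W] fixes the other variables to false, but reachability ignores them, so any base assignment
    [x] gives the same count. *)
Lemma W_sum u x : (W le u)%:R = \sum_y (agree_off (path_vars u) x y)%:R * (reaches y u)%:R :> R.
Proof.
rewrite (@sum_agree_off_base _ _ _ _ _ [ffun=> false]); last first.
  by move=> y y' /reaches_agree ->.
rewrite /W -sum1_card natr_sum [RHS]big_mkcond [LHS]big_mkcond /=.
apply: eq_bigr => y _; rewrite !inE -natrM mulnb.
have -> : agree_off (path_vars u) [ffun=> false] y = (false.-support y \subset path_vars u).
  apply/agree_offP/subsetP => H v.
    by rewrite !inE; case: (boolP (v \in path_vars u)) => [|/H]; rewrite ?inE ?ffunE // => <-.
  move=> vS; rewrite ffunE; apply/esym/negbTE; apply: contra vS => yv.
  by apply: H; rewrite inE yv.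
by rewrite /path_vars; case: ifP => // /andP [-> ->].
Qed.

Lemma W_gt0 u y : reaches y u -> (W le u)%:R != 0 :> R.
Proof.
move=> H; rewrite (W_sum u y) psumr_neq0 => [|*]; last by rewrite mulr_ge0 ?ler0n.
apply/hasP; exists y; rewrite ?mem_index_enum // H.
have -> : agree_off (path_vars u) y y by apply/agree_offP.
by rewrite mulr1 ltr01.
Qed.

(** The test for a branch excludes leaves, which [step] maps to themselves. *)
Definition enters y p u : bool :=
  if nodeE p is Branch _ _ _ then reaches y p && (step y p == u) else false.

(** A path that ends in [u] away from the root has exactly one last branch node before [u], because
    levels strictly increase along it. *)
Lemma reaches_enters y u : u != root ->
  (reaches y u)%:R = \sum_p (enters y p u)%:R :> R.
Proof.
move=> nu; case: (boolP (reaches y u)) => [ru|nr]; last first.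
  rewrite big1 // => p _; rewrite /enters; case: (nodeE p) => // v n0 n1.
  case: eqP => [e|]; rewrite ?andbF //; case: (boolP (reaches y p)) => // /reachesP [j ej].
  by case/negP: nr; apply/reachesP; exists j.+1; rewrite /= ej.
have [p pu] : exists p, enters y p u.
  case/reachesP: ru => j; elim: j => [|j IH] /=; first by move=> e; rewrite e eqxx in nu.
  set p := iter _ _ _ => e; case E: (nodeE p) => [r|v n0 n1].
    by move: e; rewrite /step E; exact: IH.
  by exists p; rewrite /enters E e eqxx andbT; apply/reachesP; exists j.
rewrite (bigD1 p) //= pu big1 ?addr0 // => q ne; apply/eqP; rewrite pnatr_eq0 eqb0.
apply: contra ne.
wlog suff H : p q pu / forall i j, (i <= j)%N -> iter i (step y) root = p ->
    iter j (step y) root = q -> enters y q u -> q == p.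
  move=> qu; move: (pu) (qu); rewrite /enters.
  case: (nodeE p) => // v n0 n1 /andP [/reachesP [i ei] _].
  case: (nodeE q) => // v' n0' n1' /andP [/reachesP [j ej] _].
  by case: (leqP i j) => [/H|/ltnW/H H']; [apply | rewrite eq_sym; apply: H'].
move=> i j ij ei ej; move: (pu); rewrite /enters.
case E: (nodeE p) => // [v n0 n1] /andP [_ /eqP ep].
case F: (nodeE q) => // [v' n0' n1'] /andP [_ /eqP eq].
move: ij; rewrite leq_eqVlt => /orP [/eqP e|ij]; first by rewrite -ei -ej e.
(* The path is at [u] right after [p], hence [q], met later, has at least the level of [u]; but [q]
   steps to [u], which forces a smaller level. *)
have := step_level y F; rewrite eq -ej -(subnK ij) iterD iterS ei ep.
by rewrite ltnNge iter_step_level_le.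
Qed.

Lemma randomizeE s x y : uniq s ->
  randomize s x y = (agree_off [set v in s] x y)%:R * (2 ^+ size s)^-1 :> R.
Proof.
elim: s x => [|v s IH] x /=.
  by rewrite set_nil agree_off0 ffunE expr0 invr1 mulr1.
case/andP=> vs us; rewrite ffunE.
transitivity (\sum_b 2^-1 * ((agree_off [set w in s] (setv x v b) y)%:R * (2 ^+ size s)^-1) : R).
  apply: eq_bigr => b _; rewrite IH // ffunE big_bool /= div1r; congr (_^-1 * _).
rewrite -big_distrr -big_distrl /= exprS invfM mulrCA; congr (_ * _).
have aE b : agree_off [set w in s] (setv x v b) y =
            agree_off [set w in v :: s] x y && (b == y v).
  apply/agree_offP/andP => [H|[/agree_offP H /eqP ->] w].
    split; last by have := H v; rewrite inE vs ffunE eqxx => ->.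
    apply/agree_offP=> w; rewrite !inE negb_or => /andP [wv ws].
    by have := H w; rewrite inE ws ffunE (negbTE wv) => ->.
  rewrite inE => ws; rewrite ffunE; case: eqP => [-> //|/eqP wv].
  by apply: H; rewrite !inE negb_or wv.
rewrite big_bool /= !aE.
by case: agree_off; case: (y v); rewrite /= ?addr0 ?add0r.
Qed.

Lemma sum_randomize s x : \sum_y randomize s x y = 1 :> R.
Proof.
elim: s x => [|v s IH] x /=.
  by rewrite (bigD1 x) //= ffunE eqxx big1 ?addr0 // => y ny; rewrite ffunE (negbTE ny).
under eq_bigr => y _ do rewrite ffunE.
rewrite exchange_big /=.
under eq_bigr => b _ do rewrite -big_distrr /= IH mulr1 ffunE.
by rewrite big_bool !big_bool /=; field.
Qed.

(** Read off from the total mass 1 of [randomize], whose value is constant on these assignments. *)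
Lemma sum_agree_off1 s x : uniq s ->
  \sum_y (agree_off [set v in s] x y)%:R = 2 ^+ size s :> R.
Proof.
move=> us; have := sum_randomize s x.
under eq_bigr => y _ do rewrite randomizeE //.
rewrite -big_distrl /= => /(canRL (mulfVK _)) -> //; first by rewrite mul1r.
by rewrite expf_neq0 // pnatr_eq0.
Qed.

Lemma edge_level p u : edge p u -> (lvl p < lvl u)%N.
Proof.
have [ordA _ _ _] := addP A; rewrite /edge; case E: (nodeE p) => // [v n0 n1].
by have [_ l0 l1] := ordA _ _ _ _ E; case/orP => /eqP ->.
Qed.

(** Every node of a diagram is connected to the root, and edges raise the level. *)
Lemma root_level u : (lvl root <= lvl u)%N.
Proof.
have [_ _ _ /(_ u)] := addP A.
case/connectP=> p; elim/last_ind: p u => [|p u' IH] u /=; first by move=> _ ->.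
rewrite rcons_path last_rcons => /andP [/IH /(_ erefl) l e] ->.
exact: leq_trans l (ltnW (edge_level e)).
Qed.

Lemma root_level_lt u : u != root -> (lvl root < lvl u)%N.
Proof.
move=> nu; have [_ _ _ /(_ u)] := addP A.
case/connectP=> p; case/lastP: p => [|p u'] /=; first by move=> _ e; rewrite e eqxx in nu.
rewrite rcons_path last_rcons => /andP [_ e] ->.
exact: leq_ltn_trans (root_level _) (edge_level e).
Qed.

Lemma uniq_between p u : uniq (between le p u).
Proof. by rewrite filter_uniq // sort_uniq enum_uniq. Qed.

Lemma mem_between p u v :
  (v \in between le p u) = (lvl p < lv v < lvl u)%N && (v \in vars A).
Proof. by rewrite mem_filter mem_ordvars. Qed.

Lemma size_between p u : size (between le p u) = (lvl u - lvl p).-1.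
Proof.
apply: size_filter_index_between; first by rewrite sort_uniq enum_uniq.
by rewrite size_ordvars level_le.
Qed.

Lemma disjoint_between p u : [disjoint [set v in between le p u] & path_vars p].
Proof.
rewrite -setI_eq0; apply/eqP/setP=> v; rewrite !inE mem_between.
by apply/negbTE/negP; lia.
Qed.

(** [path_vars u] consists of [path_vars p], the variable [v] of [p] and the skipped variables. The
    step from [p] to [u] pins down [v]. *)
Lemma agree_off_parent p u v n0 n1 x y :
  nodeE p = Branch v n0 n1 -> edge p u ->
  agree_off ([set w in between le p u] :|: path_vars p) (setv x v (n1 == u)) y =
  agree_off (path_vars u) x y && (step y p == u).
Proof.
move=> E; rewrite /edge E => e.
have [ordA red _ _] := addP A; have [vD l0 l1] := ordA _ _ _ _ E.
have lu : (lvl p < lvl u)%N by case/orP: e => /eqP ->.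
have ev : lvl p = lv v by rewrite /level E.
have ->: (step y p == u) = ((n1 == u) == y v).
  (* The diagram is reduced, so only one of the two edges of [p] leads to [u] and its label is
     determined. *)
  have /eqP/negbTE n01 := red _ _ _ _ E; have n10 : (n1 == n0) = false by rewrite eq_sym.
  by rewrite /step E; case/orP: e => /eqP ->; case: (y v); rewrite ?eqxx ?n01 ?n10.
have rl := root_level p.
apply/agree_offP/andP => [H|[/agree_offP H /eqP yv] w].
  split; last first.
    have := H v; rewrite !inE mem_between -ev ltnn /= !andbF /= => /(_ isT).
    by rewrite ffunE eqxx => ->.
  apply/agree_offP=> w wr; have := H w; rewrite ffunE.
  case: eqP => [ew|_].
    by move: wr; rewrite ew !inE vD -ev rl lu.
  apply; move: wr; rewrite !inE mem_between.
  by case: (w \in vars A) => //=; lia.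
rewrite ffunE; case: eqP => [-> //|/eqP wv]; rewrite !inE mem_between => wn.
apply: H; rewrite !inE.
have : lv v != lv w by apply: contra wv => /eqP /(vlevel_inj vD) ->.
by move: wn; case: (w \in vars A) => //=; rewrite -ev; lia.
Qed.

Lemma enters_edge y p u : enters y p u -> edge p u.
Proof.
rewrite /enters /edge /step; case: (nodeE p) => // v n0 n1 /andP [_].
by case: (y v) => /eqP ->; rewrite eqxx ?orbT.
Qed.

(** Sorts the paths to [u] by their last branch node; the skipped variables are free and contribute
    the power of 2. Thus [W u] normalizes the choice of a parent. *)
Lemma W_parents u : u != root -> (W le u)%:R = \sum_p parent_weight le u p :> R.
Proof.
move=> nu; rewrite (W_sum u [ffun=> false]).
under eq_bigr => y _ do rewrite (reaches_enters _ nu) big_distrr /=.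
rewrite exchange_big /=; apply: eq_bigr => p _; rewrite /parent_weight.
case: ifP => [e|/negP ne]; last first.
  rewrite big1 // => y _; case: (boolP (enters y p u)) => [/enters_edge //|_].
  by rewrite mulr0.
case E: (nodeE p) => [r|v n0 n1]; first by rewrite /edge E in e.
transitivity (\sum_y (agree_off ([set w in between le p u] :|: path_vars p)
     (setv [ffun=> false] v (n1 == u)) y)%:R * (reaches y p)%:R : R).
  apply: eq_bigr => y _; rewrite (agree_off_parent _ _ E e) /enters E.
  by rewrite -!natrM !mulnb andbAC andbA.
rewrite sum_agree_off_split ?disjoint_between //.
under eq_bigr => z _ do rewrite -W_sum.
by rewrite -big_distrl /= sum_agree_off1 ?uniq_between // size_between.
Qed.

Lemma climb_root f x : climb le f root x = dret x.
Proof. by case: f => [|f] /=; rewrite eqxx. Qed.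

(** With gamma skipped variables, the parent costs [2^gamma W(p) / W(u)], the random bits cost
    [2^-gamma], and the rest of the climb costs [1 / W(p)] by induction. The product [1 / W(u)] is
    the same for every parent. *)
Lemma climbE f u x y : (lvl u - lvl root <= f)%N ->
  climb le f u x y = (agree_off (path_vars u) x y)%:R * (reaches y u)%:R / (W le u)%:R.
Proof.
have path_vars_root : path_vars root = set0 by apply/setP=> v; rewrite !inE; lia.
have Wroot : (W le root)%:R = 1 :> R.
  rewrite (W_sum root [ffun=> false]) path_vars_root (bigD1 [ffun=> false]) //= agree_off0 eqxx.
  rewrite /reaches connect0 mulr1 big1 ?addr0 // => z nz.
  by rewrite agree_off0 (negbTE nz) mul0r.
elim: f u x y => [|f IH] u x y lu; (have [->|nu] := eqVneq u root;
  first by rewrite climb_root ffunE Wroot divr1 path_vars_root agree_off0 /reaches connect0 mulr1).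
  (* Without fuel the level of [u] is that of the root, so [u] is the root. *)
  by have := root_level_lt nu; lia.
rewrite /= (negbTE nu) ffunE (reaches_enters y nu) big_distrr big_distrl /=.
apply: eq_bigr => p _; rewrite ffunE -(W_parents nu) /parent_weight.
case: ifP => [e|/negP ne]; last first.
  by case: (boolP (enters y p u)) => [/enters_edge //|_]; rewrite mulr0 !mul0r.
case E: (nodeE p) => [r|v n0 n1]; first by rewrite /edge E in e.
rewrite ffunE.
under eq_bigr => z _.
  rewrite randomizeE ?uniq_between // IH; last by have := edge_level e; lia.
  rewrite size_between -!mulrA.
over.
rewrite /=.
transitivity (2 ^+ (lvl u - lvl p).-1 * (W le p)%:R / (W le u)%:R *
  \sum_z (agree_off [set w in between le p u] (setv x v (n1 == u)) z)%:R *
   (2 ^- (lvl u - lvl p).-1 * ((reaches y p)%:R / (W le p)%:R) *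
      (agree_off (path_vars p) z y)%:R) : R).
  by congr (_ * _); apply: eq_bigr => z _; rewrite -[in RHS]mulrA; do 2!congr (_ * _); rewrite mulrC.
rewrite (sum_agree_offU _ _ (fun=> _)) ?disjoint_between //.
rewrite (agree_off_parent _ _ E e) /enters E.
have [ry|_] := boolP (reaches y p); last by rewrite !(mul0r, mulr0).
rewrite mul1r andTb -mulnb natrM.
have := W_gt0 ry; have : 2 ^+ (lvl u - lvl p).-1 != 0 :> R by rewrite expf_neq0 // pnatr_eq0.
move: (W le p)%:R (W le u)%:R^-1 (2 ^+ _) => a b c hc ha; by field; rewrite hc ha.
Qed.

Definition leaf_value u : R := if nodeE u is Leaf r then r else 0.

Lemma leaf_weightE u : leaf_weight le u = leaf_value u * (W le u)%:R.
Proof. by rewrite /leaf_weight /leaf_value; case: (nodeE u) => //; rewrite mul0r. Qed.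

(** A path reaches exactly one leaf, and [leaf_value] vanishes on branch nodes; this form can be
    exchanged with sums over assignments. *)
Lemma evalE y : eval A y = \sum_u leaf_value u * (reaches y u)%:R.
Proof.
set u := iter #|vars A| (step y) root.
have leafE l : reaches y l -> (if nodeE l is Leaf _ then True else False) -> u = l.
  case/reachesP=> j ej leafl.
  have fixl i : iter i (step y) l = l.
    elim: i => //= i ->; rewrite /step; by case: (nodeE l) leafl.
  case: (leqP j #|vars A|) => jn.
    by rewrite /u -(subnK jn) iterD ej fixl.
  (* As long as no leaf is met, the level is at least the number of steps; branch levels stay below
     [#|vars A|], so that many steps end in a leaf. *)
  have lev i : (if nodeE (iter i (step y) root) is Leaf _ then true
      else (i <= lvl (iter i (step y) root)))%N.
    elim: i => [|i IH] /=; first by case: nodeE.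
    move: IH; case E: (nodeE (iter i (step y) root)) => [r|v n0 n1] IH; last first.
      by have := leq_ltn_trans IH (step_level y E); case: (nodeE _).
    by rewrite /step E E.
  have := lev #|vars A|; rewrite -/u.
  case E: (nodeE u) => [r|v n0 n1]; last first.
    have [ordA _ _ _] := addP A; have [vD _ _] := ordA _ _ _ _ E.
    by rewrite /level E leqNgt vlevel_lt.
  move=> _; have fixu i : iter i (step y) u = u.
    by elim: i => //= i ->; rewrite /step E.
  by rewrite -ej -(subnK (ltnW jn)) iterD fixu.
rewrite (bigD1 u) //= big1 ?addr0 => [|l nl].
  by rewrite /reaches fconnect_iter mulr1.
case: (boolP (reaches y l)) => [rl|_]; last by rewrite mulr0.
rewrite /leaf_value; have := leafE l rl; case: (nodeE l) => [r /(_ I) e|v n0 n1 _].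
  by rewrite e eqxx in nl.
by rewrite mul0r.
Qed.

Local Notation above := [set v in above_root le A].

Lemma path_vars_leaf u r : nodeE u = Leaf r -> path_vars u :|: above = vars A.
Proof.
move=> E; apply/setP=> v; rewrite !inE mem_filter mem_ordvars /level E.
case: (boolP (v \in vars A)) => [vD|] /=; last by rewrite andbF.
by rewrite vlevel_lt //= andbT; lia.
Qed.

Lemma disjoint_path_vars_above u : [disjoint path_vars u & above].
Proof.
rewrite -setI_eq0; apply/eqP/setP=> v; rewrite !inE mem_filter.
by apply/negbTE/negP; lia.
Qed.

Lemma uniq_above_root : uniq (above_root le A).
Proof. by rewrite filter_uniq // sort_uniq enum_uniq. Qed.

(** Each leaf [l] is reached by [W(l)] settings of the variables from the root's level on; the
    variables above the root are free and give the power of 2. *)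
Lemma sum_eval x : \sum_y (agree_off (vars A) x y)%:R * eval A y =
  2 ^+ size (above_root le A) * \sum_(u : node A) leaf_weight le u.
Proof.
under eq_bigr => y _ do rewrite evalE big_distrr /=.
rewrite exchange_big big_distrr /=; apply: eq_bigr => u _; rewrite leaf_weightE /leaf_value.
case E: (nodeE u) => [r|v n0 n1]; last first.
  by rewrite mul0r mulr0 big1 // => y _; rewrite mul0r mulr0.
under eq_bigr => y _ do rewrite mulrCA.
rewrite -big_distrr /= -(path_vars_leaf E) setUC sum_agree_off_split; last first.
  by rewrite disjoint_sym disjoint_path_vars_above.
under eq_bigr => z _ do rewrite -W_sum.
by rewrite -big_distrl /= sum_agree_off1 ?uniq_above_root // mulrCA.
Qed.

(** The factor [W(l)] in the weight of a leaf cancels the [1 / W(l)] of the climb, leaving the leaf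
    value. If the total is 0, both sides are 0 since division by 0 yields 0. *)
Lemma sampleADDE y : sampleADD le A y =
  (agree_off (vars A) [ffun=> false] y)%:R * eval A y /
  \sum_z (agree_off (vars A) [ffun=> false] z)%:R * eval A z.
Proof.
rewrite sum_eval evalE /sampleADD ffunE big_distrr big_distrl /=.
apply: eq_bigr => l _; rewrite !ffunE.
transitivity (leaf_weight le l / (\sum_(u : node A) leaf_weight le u) *
  \sum_z (agree_off (path_vars l) [ffun=> false] z)%:R *
    ((reaches z l)%:R / (W le l)%:R * (2 ^+ size (above_root le A))^-1 *
      (agree_off above z y)%:R)).
  congr (_ * _); apply: eq_bigr => z _; rewrite randomizeE ?uniq_above_root //.
  rewrite climbE; last exact: leq_trans (leq_subr _ _) (level_le _).
  by rewrite -!mulrA; do 3!congr (_ * _); rewrite mulrC.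
rewrite (sum_agree_offU _ _ (fun z => (reaches z l)%:R / (W le l)%:R *
  (2 ^+ size (above_root le A))^-1)) ?disjoint_path_vars_above //.
have -> : reaches (mix (path_vars l) y [ffun=> false]) l = reaches y l.
  by apply: reaches_agree; apply/agree_offP=> v; rewrite inE negbK ffunE => ->.
rewrite leaf_weightE /leaf_value; case E: (nodeE l) => [r|v n0 n1]; last first.
  by rewrite !mul0r mulr0 mul0r.
rewrite (path_vars_leaf E).
have [ry|_] := boolP (reaches y l); last by rewrite !(mul0r, mulr0).
rewrite invfM mul1r mulr1; have := W_gt0 ry.
by move: (W le l)%:R (\sum_u _)^-1 (2 ^+ _)^-1 => a b c ha; field.
Qed.

End Sampling.

(** * Counting paths whose length is a power of 2 *)

Section Paths.
Context {R : realType} {k m N : nat}.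
Variable M : tsystem k m.
Implicit Types (w z : tseq k N) (s : bits k).

Fixpoint npaths (i : nat) (s s' : bits k) : nat :=
  if i is j.+1 then (\sum_b npaths j s b * npaths j b s')%N else trel M s s'.

Definition valid_path (lo hi : nat) w : bool :=
  [forall j : 'I_N, (lo <= j < hi)%N ==> trel M (get w j) (get w j.+1)].

(** The positions that a recursive call on [lo], [hi] fills. Both bounds are strict because the end
    states are already set, which also makes the two halves disjoint. *)
Definition inner (lo hi : nat) : {set 'I_N.+1} := [set i : 'I_N.+1 | (lo < i < hi)%N].

Lemma validP lo hi w : (hi <= N)%N ->
  reflect (forall j, (lo <= j < hi)%N -> trel M (get w j) (get w j.+1)) (valid_path lo hi w).
Proof.
move=> hN; apply: (iffP forallP) => [H j jlh|H j]; last by apply/implyP/H.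
have jN : (j < N)%N by lia.
by have /implyP := H (Ordinal jN); apply.
Qed.

Lemma valid_cat lo mid hi w : (lo <= mid <= hi)%N -> (hi <= N)%N ->
  valid_path lo hi w = valid_path lo mid w && valid_path mid hi w.
Proof.
move=> lmh hN; have mN : (mid <= N)%N by lia.
apply/(validP _ _ hN)/andP => [H|[/(validP _ _ mN) H1 /(validP _ _ hN) H2] j jlh].
  by split; apply/validP=> // j jlh; apply: H; lia.
by case: (ltnP j mid) => jm; [apply: H1 | apply: H2]; lia.
Qed.

Lemma get_agree lo hi w z j : agree_off (inner lo hi) w z -> (j <= N)%N ->
  ~~ (lo < j < hi)%N -> get w j = get z j.
Proof. by move=> /agree_offP H jN jlh; apply: H; rewrite inE inordK. Qed.

(** The two intervals meet in an endpoint at most, and endpoints are not rewritten. *)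
Lemma valid_agree lo hi lo' hi' w z : (hi' <= N)%N ->
  (hi' <= lo)%N || (hi <= lo')%N ->
  agree_off (inner lo hi) w z -> valid_path lo' hi' w = valid_path lo' hi' z.
Proof.
move=> hN dis ag.
have H j : (lo' <= j < hi')%N -> get w j = get z j /\ get w j.+1 = get z j.+1.
  by move=> jlh; split; apply: (get_agree ag); lia.
by apply/validP/validP => // V j jlh; have := V j jlh; have [-> ->] := H j jlh.
Qed.

Lemma get_put j b w : get (put j b w) j = b.
Proof. by rewrite /get ffunE eqxx. Qed.

Lemma inord_eq i j : (i <= N)%N -> (j <= N)%N ->
  ((inord i : 'I_N.+1) == inord j) = (i == j).
Proof. by move=> iN jN; rewrite -val_eqE /= !inordK. Qed.

Lemma get_put_neq i j b w : (i <= N)%N -> (j <= N)%N -> i != j ->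
  get (put j b w) i = get w i.
Proof. by move=> iN jN /negbTE ij; rewrite /get ffunE inord_eq // ij. Qed.

(** Since position [j] is not rewritten again, the value put there must be the final one. *)
Lemma agree_off_put (S : {set 'I_N.+1}) j b w z : inord j \notin S ->
  agree_off S (put j b w) z = agree_off (inord j |: S) w z && (b == get z j).
Proof.
move=> jS; apply/agree_offP/andP => [H|[/agree_offP H /eqP ->] i iS].
  split; last by have := H _ jS; rewrite ffunE eqxx => ->.
  apply/agree_offP=> i; rewrite !inE negb_or => /andP [ij iS].
  by rewrite -H // ffunE (negbTE ij).
rewrite ffunE; case: eqP => [-> //|/eqP ij].
by apply: H; rewrite !inE negb_or ij.
Qed.

Lemma sum_agree_off_put j w (F : tseq k N -> R) :
  \sum_z (agree_off [set inord j] w z)%:R * F z = \sum_b F (put j b w).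
Proof.
have E z : (agree_off [set inord j] w z)%:R = \sum_b (z == put j b w)%:R :> R.
  rewrite (bigD1 (get z j)) //= big1 ?addr0 => [|b nb].
    by rewrite -agree_off0 agree_off_put ?inE // setU0 eqxx andbT.
  by rewrite -agree_off0 agree_off_put ?inE // (negbTE nb) andbF.
under eq_bigr => z _ do rewrite E big_distrl /=.
rewrite exchange_big; apply: eq_bigr => b _.
rewrite (bigD1 (put j b w)) //= eqxx mul1r big1 ?addr0 // => z nz.
by rewrite (negbTE nz) mul0r.
Qed.

Lemma inner_split lo mid hi : (lo < mid < hi)%N -> (hi <= N)%N ->
  inner lo hi = inord mid |: (inner lo mid :|: inner mid hi).
Proof.
move=> lmh hN; apply/setP=> i; rewrite !inE -val_eqE /= inordK; lia.
Qed.

Lemma disjoint_inner lo mid hi : [disjoint inner lo mid & inner mid hi].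
Proof.
by rewrite -setI_eq0; apply/eqP/setP=> i; rewrite !inE; lia.
Qed.

Lemma inner0 lo : inner lo lo.+1 = set0.
Proof. by apply/setP=> i; rewrite !inE; lia. Qed.

(** Identifies [npaths] with the number of valid fillings between fixed ends: summing over the
    middle state separates the two halves, as in the recursion of [npaths]. *)
Lemma sum_valid i lo hi w : hi = (lo + 2 ^ i)%N -> (hi <= N)%N ->
  \sum_z (agree_off (inner lo hi) w z)%:R * (valid_path lo hi z)%:R =
  (npaths i (get w lo) (get w hi))%:R :> R.
Proof.
elim: i lo hi w => [|i IH] lo hi w.
  rewrite expn0 addn1 => -> loN; rewrite inner0 (bigD1 w) //= big1 ?addr0 => [|z nz].
    rewrite agree_off0 eqxx mul1r; congr (nat_of_bool _)%:R.
    apply/(validP _ _ loN)/idP => [->|H j jlo]; first by []; last by have -> : j = lo by lia.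
    by rewrite leqnn ltnSn.
  by rewrite agree_off0 (negbTE nz) mul0r.
rewrite expnS mul2n -addnn => ehi hN; pose mid := (lo + 2 ^ i)%N.
have p2 : (0 < 2 ^ i)%N by rewrite expn_gt0.
have lm : (lo < mid)%N by rewrite /mid; lia.
have mh : (mid < hi)%N by rewrite /mid; lia.
have dm : [disjoint [set inord mid] & inner lo mid :|: inner mid hi].
  by rewrite disjoints1 !inE inordK; lia.
rewrite (@inner_split lo mid hi) ?lm // sum_agree_off_split // sum_agree_off_put.
rewrite /= natr_sum; apply: eq_bigr => b _.
rewrite sum_agree_off_split ?disjoint_inner // natrM.
have mN : (mid <= N)%N by lia.
have loN : (lo <= N)%N by lia.
have -> : npaths i (get w lo) b =
    npaths i (get (put mid b w) lo) (get (put mid b w) mid).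
  by rewrite get_put get_put_neq //; lia.
rewrite -IH // big_distrl /=.
apply: eq_bigr => z _; have [az|_] := boolP (agree_off (inner lo mid) _ z); last first.
  by rewrite !mul0r.
rewrite !mul1r.
have -> : get w hi = get z hi.
  by rewrite -(get_agree az) ?get_put_neq //; lia.
have -> : b = get z mid by rewrite -(get_agree az) ?get_put //; lia.
rewrite -IH //; last by rewrite /mid; lia.
rewrite big_distrr; apply: eq_bigr => z' _ /=.
have [az'|_] := boolP (agree_off (inner mid hi) z z'); last by rewrite !mul0r mulr0.
rewrite (@valid_cat lo mid hi) //; last by rewrite (ltnW lm) ltnW.
by rewrite !mul1r -mulnb natrM (valid_agree _ _ az') // leqnn.
Qed.

(** The middle state of [w] itself yields a positive summand. Later divisions by path counts rely on
    this. *)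
Lemma npaths_gt0 i lo hi w : hi = (lo + 2 ^ i)%N -> (hi <= N)%N -> valid_path lo hi w ->
  (0 < npaths i (get w lo) (get w hi))%N.
Proof.
elim: i lo hi => [|i IH] lo hi.
  rewrite expn0 addn1 => -> loN /(validP _ _ loN) /(_ lo) /=.
  by rewrite leqnn ltnSn => ->.
rewrite expnS mul2n -addnn => ehi hN; pose mid := (lo + 2 ^ i)%N.
rewrite (@valid_cat lo mid hi) //; last by rewrite /mid; lia.
case/andP=> v1 v2; rewrite /= (bigD1 (get w mid)) //= addn_gt0 muln_gt0.
by rewrite !IH //; rewrite /mid; lia.
Qed.

End Paths.

(** * The functions represented by the constructed diagrams, and the law of each call of the
    sampler *)

Section Diagrams.
Context {R : realType} {k m n : nat} {le : rel (xvar k n)}.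
Variables (P : add_package R le) (M : tsystem k m).
Implicit Types (x y : asg (xvar k n)) (s : bits k).
Local Notation X := (@X k n).
Local Notation np i s s' := ((npaths M i s s')%:R : R).

Lemma inord_copy_eq c c' : (c <= n.+1)%N -> (c' <= n.+1)%N ->
  ((inord c : 'I_n.+2) == inord c') = (c == c').
Proof. by move=> h h'; rewrite -val_eqE /= !inordK. Qed.

Lemma getX_setX c s x : getX c (Defs.setX c s x) = s.
Proof. by apply/ffunP=> j; rewrite !ffunE /= eqxx. Qed.

Lemma getX_setX_neq c c' s x : (c <= n.+1)%N -> (c' <= n.+1)%N -> c != c' ->
  getX c (Defs.setX c' s x) = getX c x.
Proof.
by move=> h h' /negbTE ne; apply/ffunP=> j; rewrite !ffunE /= inord_copy_eq // ne.
Qed.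

Lemma getX_local (D : {set xvar k n}) c x y : {in D, x =1 y} -> X c \subset D ->
  getX c x = getX c y.
Proof.
move=> H /subsetP sub; apply/ffunP=> j; rewrite !ffunE; apply: H; apply: sub.
by rewrite inE.
Qed.

Lemma disjointX c c' : (c <= n.+1)%N -> (c' <= n.+1)%N -> c != c' ->
  [disjoint X c & X c'].
Proof.
move=> h h' ne; rewrite -setI_eq0; apply/eqP/setP=> v; rewrite !inE.
by apply/negbTE/negP=> /andP [/eqP ->]; rewrite inord_copy_eq // (negbTE ne).
Qed.

Lemma sum_agree_offX c x (F : asg (xvar k n) -> R) :
  \sum_y (agree_off (X c) x y)%:R * F y = \sum_s F (Defs.setX c s x).
Proof.
have aE y s : agree_off (X c) x y && (s == getX c y) = (y == Defs.setX c s x).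
  apply/andP/eqP => [[/agree_offP H /eqP ->]|->].
    apply/ffunP=> -[i j]; rewrite !ffunE /=; case: eqP => [-> //|/eqP ne].
    by rewrite H // inE.
  split; last by rewrite getX_setX.
  by apply/agree_offP=> v; rewrite inE ffunE => /negbTE ->.
have E y : (agree_off (X c) x y)%:R = \sum_s (y == Defs.setX c s x)%:R :> R.
  rewrite (bigD1 (getX c y)) //= -aE eqxx andbT big1 ?addr0 // => s ns.
  by rewrite -aE (negbTE ns) andbF.
under eq_bigr => y _ do rewrite E big_distrl /=.
rewrite exchange_big; apply: eq_bigr => s _.
rewrite (bigD1 (Defs.setX c s x)) //= eqxx mul1r big1 ?addr0 // => y ny.
by rewrite (negbTE ny) mul0r.
Qed.

(** The variable set belongs to the invariant because [mk_eval] asks that a function depend only on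
    the declared variables. *)
Definition iter_g_spec i := vars (iter_g P M i) = X 0 :|: X i.+1 /\
  forall x, eval (iter_g P M i) x = np i (getX 0 x) (getX i.+1 x).

Lemma iter_tE i x : (0 < i)%N -> (i <= n)%N -> iter_g_spec i.-1 ->
  vars (iter_t P i (iter_g P M i.-1)) = (X 0 :|: X i) :|: (X i :|: X i.+1) /\
  eval (iter_t P i (iter_g P M i.-1)) x =
    np i.-1 (getX 0 x) (getX i x) * np i.-1 (getX i x) (getX i.+1 x).
Proof.
move=> i0 iN [vg eg]; rewrite prednK // in vg eg.
have shiftE y : eval (add_shift P i (iter_g P M i.-1)) y =
    np i.-1 (getX i y) (getX i.+1 y).
  have hE z : eval (iter_g P M i.-1)
      (Defs.setX 0 (getX i z) (Defs.setX i (getX i.+1 z) z)) =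
      np i.-1 (getX i z) (getX i.+1 z).
    by rewrite eg getX_setX getX_setX_neq ?getX_setX //; lia.
  rewrite mk_eval // => z z' H; rewrite !hE.
  by rewrite (getX_local H (subsetUl _ _)) (getX_local H (subsetUr _ _)).
split; first by rewrite mk_vars vg mk_vars.
rewrite mk_eval ?eg ?shiftE // => z z'; rewrite vg mk_vars => H.
rewrite !eg !shiftE.
have -> : getX 0 z = getX 0 z'.
  by apply: (getX_local H); rewrite -setUA subsetUl.
have -> : getX i z = getX i z'.
  by apply: (getX_local H); apply: subset_trans (subsetUl _ _) (subsetUr _ _).
have -> // : getX i.+1 z = getX i.+1 z'.
by apply: (getX_local H); rewrite setUA subsetUr.
Qed.

Lemma iter_gP i : (i <= n)%N -> iter_g_spec i.
Proof.
elim: i => [|i IH] hi.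
  split; first by rewrite mk_vars.
  move=> x; rewrite mk_eval // => y z H.
  by rewrite (getX_local H (subsetUl _ _)) (getX_local H (subsetUr _ _)).
have {}IH := IH (ltnW hi).
have [vt et] : vars (iter_t P i.+1 (iter_g P M i)) =
    (X 0 :|: X i.+1) :|: (X i.+1 :|: X i.+2) /\
  forall x, eval (iter_t P i.+1 (iter_g P M i)) x =
    np i (getX 0 x) (getX i.+1 x) * np i (getX i.+1 x) (getX i.+2 x).
  have H x := @iter_tE i.+1 x isT hi IH.
  by split=> [|x]; [have [] := H [ffun=> false] | have [] := H x].
have D : vars (iter_t P i.+1 (iter_g P M i)) :\: X i.+1 = X 0 :|: X i.+2.
  rewrite vt; apply/setP=> v; rewrite !inE.
  case: (v.1 =P inord i.+1) => [->|] /=; last by rewrite orbF.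
  by rewrite !inord_copy_eq //; lia.
have hE x : \sum_s eval (iter_t P i.+1 (iter_g P M i)) (Defs.setX i.+1 s x) =
    np i.+1 (getX 0 x) (getX i.+2 x).
  rewrite /= natr_sum; apply: eq_bigr => s _; rewrite et natrM getX_setX.
  by rewrite !getX_setX_neq //; lia.
split; first by rewrite /= mk_vars D.
move=> x; rewrite /= mk_eval ?hE // => y z; rewrite D => H; rewrite !hE.
by rewrite (getX_local H (subsetUl _ _)) (getX_local H (subsetUr _ _)).
Qed.

(** After both substitutions only copy [i] is left, so a draw is a draw of the middle state; its
    normalizer is the recursion step of [npaths]. *)
Lemma sampleFromADD_lt (N : nat) i lo hi (w z : tseq k N) :
  (0 < i)%N -> (i < n)%N ->
  sampleFromADD P i (makeADDs P M i) lo hi w z =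
  \sum_s np i.-1 (get w lo) s * np i.-1 s (get w hi) /
    np i (get w lo) (get w hi) * (z == put ((lo + hi) %/ 2) s w)%:R.
Proof.
move=> i0 iN; rewrite /sampleFromADD /makeADDs (ltn_eqF iN) ffunE.
set t := iter_t P i _; set a := get w lo; set c := get w hi.
have H x := iter_tE x i0 (ltnW iN) (iter_gP (leq_trans (leq_pred i) (ltnW iN))).
have vt : vars t = (X 0 :|: X i) :|: (X i :|: X i.+1) by have [] := H [ffun=> false].
have {H} et x : eval t x =
    np i.-1 (getX 0 x) (getX i x) * np i.-1 (getX i x) (getX i.+1 x).
  by have [] := H x.
set t1 := add_subst P 0 a t; set t2 := add_subst P i.+1 c t1.
have D1 : vars t1 = X i :|: X i.+1.
  rewrite mk_vars vt; apply/setP=> v; rewrite !inE.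
  case: (v.1 =P inord 0) => [->|] /=; last by rewrite orbA orbb.
  by rewrite !inord_copy_eq //; lia.
have D2 : vars t2 = X i.
  rewrite mk_vars D1; apply/setP=> v; rewrite !inE.
  case: (v.1 =P inord i.+1) => [->|] /=; last by rewrite orbF.
  by rewrite !inord_copy_eq //; lia.
have h1 x : eval t (Defs.setX 0 a x) =
    np i.-1 a (getX i x) * np i.-1 (getX i x) (getX i.+1 x).
  by rewrite et getX_setX !getX_setX_neq //; lia.
have e1 x : eval t1 x = np i.-1 a (getX i x) * np i.-1 (getX i x) (getX i.+1 x).
  have D : vars t :\: X 0 = X i :|: X i.+1 by rewrite -D1; exact/esym/mk_vars.
  rewrite mk_eval ?h1 // => y y'; rewrite D => H; rewrite !h1.
  by rewrite (getX_local H (subsetUl _ _)) (getX_local H (subsetUr _ _)).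
have h2 x : eval t1 (Defs.setX i.+1 c x) = np i.-1 a (getX i x) * np i.-1 (getX i x) c.
  by rewrite e1 getX_setX !getX_setX_neq //; lia.
have e2 x : eval t2 x = np i.-1 a (getX i x) * np i.-1 (getX i x) c.
  have D : vars t1 :\: X i.+1 = X i by rewrite -D2; exact/esym/mk_vars.
  rewrite mk_eval ?h2 // => y y'; rewrite D => H; rewrite !h2.
  by rewrite (getX_local H (subxx _)).
have Z : \sum_y (agree_off (vars t2) [ffun=> false] y)%:R * eval t2 y = np i a c.
  rewrite D2 sum_agree_offX -[i in RHS](prednK i0) /= natr_sum.
  by apply: eq_bigr => s _; rewrite e2 getX_setX natrM.
under eq_bigr => x _ do rewrite sampleADDE Z D2 e2 -!mulrA ffunE.
by rewrite sum_agree_offX; apply: eq_bigr => s _; rewrite getX_setX -!mulrA.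
Qed.

Definition triple_weight a b c : R :=
  np n.-1 a b * np n.-1 b c * (c \in target M)%:R * (a \in init M)%:R.

(** At the top level nothing is substituted: the draw fixes a triple of states, weighted by path
    counts and the two endpoint conditions. *)
Lemma sampleFromADD_eq (N : nat) lo hi (w z : tseq k N) : (0 < n)%N ->
  sampleFromADD P n (makeADDs P M n) lo hi w z =
  \sum_a \sum_c \sum_b triple_weight a b c /
    (\sum_a' \sum_c' \sum_b' triple_weight a' b' c') *
    (z == put hi c (put ((lo + hi) %/ 2) b (put lo a w)))%:R.
Proof.
move=> n0; rewrite /sampleFromADD /makeADDs eqxx ffunE.
set t := iter_t P n _.
have H x := iter_tE x n0 (leqnn n) (iter_gP (leq_pred n)).
have vt : vars t = (X 0 :|: X n) :|: (X n :|: X n.+1) by have [] := H [ffun=> false].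
have {H} et x : eval t x =
    np n.-1 (getX 0 x) (getX n x) * np n.-1 (getX n x) (getX n.+1 x).
  by have [] := H x.
set t1 := add_mul P t _; set t2 := add_mul P t1 _.
have targetE x : eval (add_target P M n.+1) x = (getX n.+1 x \in target M)%:R.
  by rewrite mk_eval // => y y' H; rewrite (getX_local H (subxx _)).
have initE x : eval (add_init P M 0) x = (getX 0 x \in init M)%:R.
  by rewrite mk_eval // => y y' H; rewrite (getX_local H (subxx _)).
have D1 : vars t1 = X 0 :|: (X n.+1 :|: X n).
  by rewrite mk_vars vt mk_vars; apply/setP=> v; rewrite !inE; do !case: eqP.
have D2 : vars t2 = X 0 :|: (X n.+1 :|: X n).
  by rewrite mk_vars D1 mk_vars; apply/setP=> v; rewrite !inE; do !case: eqP.
have loc y y' : {in X 0 :|: (X n.+1 :|: X n), y =1 y'} ->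
    [/\ getX 0 y = getX 0 y', getX n y = getX n y' & getX n.+1 y = getX n.+1 y'].
  move=> H; split; apply: (getX_local H); rewrite ?subsetUl //.
    by rewrite setUA subsetUr.
  by apply: subset_trans (subsetUl _ _) (subsetUr _ _).
have e1 x : eval t1 x = np n.-1 (getX 0 x) (getX n x) *
    np n.-1 (getX n x) (getX n.+1 x) * (getX n.+1 x \in target M)%:R.
  have D : vars t :|: vars (add_target P M n.+1) = vars t1 by exact/esym/mk_vars.
  rewrite mk_eval ?et ?targetE // => y y'; rewrite D D1 => /loc [e0 en eS].
  by rewrite !et !targetE e0 en eS.
have e2 x : eval t2 x = triple_weight (getX 0 x) (getX n x) (getX n.+1 x).
  rewrite mk_eval ?e1 ?initE // => y y'.
  have -> : vars t1 :|: vars (add_init P M 0) = vars t2 by exact/esym/mk_vars.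
  by rewrite D2 => /loc [e0 en eS]; rewrite !e1 !initE e0 en eS.
(* Copies 0, [n] and [n.+1] are pairwise disjoint because [n] is positive. *)
have sumE (F : asg (xvar k n) -> R) : \sum_y (agree_off (vars t2) [ffun=> false] y)%:R * F y =
    \sum_a \sum_c \sum_b F (Defs.setX n b (Defs.setX n.+1 c (Defs.setX 0 a [ffun=> false]))).
  have dn : [disjoint X n.+1 & X n] by apply: disjointX; lia.
  have d0 : [disjoint X 0 & X n.+1 :|: X n].
    by rewrite -setI_eq0 setIUr setU_eq0 !setI_eq0 !disjointX //; lia.
  rewrite D2 sum_agree_off_split // sum_agree_offX; apply: eq_bigr => a _.
  rewrite sum_agree_off_split // sum_agree_offX; apply: eq_bigr => c _.
  by rewrite sum_agree_offX.
have gE a b c x : let y := Defs.setX n b (Defs.setX n.+1 c (Defs.setX 0 a x)) in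
    [/\ getX 0 y = a, getX n y = b & getX n.+1 y = c].
  split; rewrite ?getX_setX //; first by rewrite 2?getX_setX_neq ?getX_setX //; lia.
  by rewrite getX_setX_neq ?getX_setX //; lia.
under eq_bigr => x _ do rewrite sampleADDE sumE -!mulrA ffunE.
have wE a b c : eval t2 (Defs.setX n b (Defs.setX n.+1 c (Defs.setX 0 a [ffun=> false]))) =
    triple_weight a b c.
  by rewrite e2; have [-> -> ->] := gE a b c [ffun=> false].
rewrite sumE; apply: eq_bigr => a _; apply: eq_bigr => c _; apply: eq_bigr => b _.
have [-> -> ->] := gE a b c [ffun=> false]; rewrite wE mulrA; congr (_ / _ * _).
by apply: eq_bigr => a' _; apply: eq_bigr => c' _; apply: eq_bigr => b' _.
Qed.

End Diagrams.

Local Arguments npaths : simpl never.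

(** * Telescoping along the recursion, and uniformity of the trace *)

Section Uniformity.
Context {R : realType} {k m n N : nat} {le : rel (xvar k n)}.
Variables (P : add_package R le) (M : tsystem k m).
Implicit Types (w z : tseq k N).
Local Notation np i s s' := ((npaths M i s s')%:R : R).
Local Notation recT := (Defs.rec P (makeADDs P M) (N := N)).

(** Uniformity of the recursive call over the valid fillings between its ends. Validity of [z] keeps
    the denominator nonzero. *)
Definition rec_spec j := forall lo hi w z, hi = (lo + 2 ^ j)%N -> (hi <= N)%N ->
  valid_path M lo hi z ->
  recT j lo hi w z =
    (agree_off (inner lo hi) w z)%:R / np j (get z lo) (get z hi).

(** The second call starts from the output of the first but rewrites only the right half, so the two
    probabilities multiply. *)
Lemma rec_pairE j lo mid hi w z : rec_spec j ->
  mid = (lo + 2 ^ j)%N -> hi = (mid + 2 ^ j)%N -> (hi <= N)%N -> valid_path M lo hi z ->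
  dbind (recT j lo mid w) (recT j mid hi) z =
  (agree_off (inner lo mid :|: inner mid hi) w z)%:R /
    (np j (get z lo) (get z mid) * np j (get z mid) (get z hi)).
Proof.
move=> spec emid ehi hN; have p2 : (0 < 2 ^ j)%N by rewrite expn_gt0.
have mN : (mid <= N)%N by lia.
rewrite (@valid_cat _ _ _ M lo mid hi) //; last by lia.
case/andP=> v1 v2; rewrite ffunE.
transitivity (\sum_z' (agree_off (inner lo mid) w z')%:R *
  ((np j (get z lo) (get z mid) * np j (get z mid) (get z hi))^-1 *
   (agree_off (inner mid hi) z' z)%:R)).
  apply: eq_bigr => z' _; rewrite (spec mid hi) //.
  have [ag|_] := boolP (agree_off (inner mid hi) z' z); last by rewrite !(mul0r, mulr0).
  rewrite (spec lo mid) //; last by rewrite (valid_agree _ _ _ ag) // leqnn.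
  have e1 : get z' lo = get z lo by apply: (get_agree ag); lia.
  have e2 : get z' mid = get z mid by apply: (get_agree ag); lia.
  by rewrite e1 e2 invfM mulr1 mul1r mulrA.
by rewrite (sum_agree_offU _ _ (fun=> _)) ?disjoint_inner // mulrC.
Qed.

Lemma recE i : (i < n)%N -> rec_spec i.
Proof.
elim: i => [|i IH] iN lo hi w z.
  rewrite expn0 addn1 => -> loN /(validP _ _ _ loN) /(_ lo).
  rewrite leqnn ltnSn => /(_ isT) tr.
  (* Nothing is left to fill, and the path count is 1 because [z] makes this single step. *)
  by rewrite /= ffunE inner0 agree_off0 /npaths tr divr1.
rewrite expnS mul2n -addnn => ehi hN vz.
have p2 : (0 < 2 ^ i)%N by rewrite expn_gt0.
have emid : ((lo + hi) %/ 2 = lo + 2 ^ i)%N by lia.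
pose mid := (lo + 2 ^ i)%N.
have lm : (lo < mid)%N by rewrite /mid; lia.
have mh : (mid < hi)%N by rewrite /mid; lia.
have mN : (mid <= N)%N by lia.
have loN : (lo <= N)%N by lia.
have {}IH := IH (ltnW iN).
have md : (inord mid : 'I_N.+1) \notin inner lo mid :|: inner mid hi.
  by rewrite !inE inordK; lia.
rewrite [LHS]/= emid -/mid ffunE.
under eq_bigr => w1 _.
  rewrite (@rec_pairE _ _ _ _ _ _ IH) //; last by rewrite /mid; lia.
  rewrite sampleFromADD_lt // emid -/mid big_distrl /=.
over.
rewrite exchange_big /=.
have E b : \sum_w1 np i (get w lo) b * np i b (get w hi) /
      np i.+1 (get w lo) (get w hi) * (w1 == put mid b w)%:R *
      ((agree_off (inner lo mid :|: inner mid hi) w1 z)%:R /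
        (np i (get z lo) (get z mid) * np i (get z mid) (get z hi))) =
    (b == get z mid)%:R * ((agree_off (inner lo hi) w z)%:R /
      np i.+1 (get z lo) (get z hi)).
  rewrite (bigD1 (put mid b w)) //= eqxx mulr1 big1 ?addr0; last first.
    by move=> w1 /negbTE ->; rewrite mulr0 mul0r.
  rewrite agree_off_put // -inner_split ?lm //.
  have [ag|_] := boolP (agree_off _ w z); last by rewrite !(mul0r, mulr0).
  have [->|_] := eqVneq b (get z mid); last by rewrite !(mul0r, mulr0).
  have -> : get w lo = get z lo by apply: (get_agree ag); lia.
  have -> : get w hi = get z hi by apply: (get_agree ag); lia.
  (* The telescoping: the numerator of the middle draw cancels the two counts from the halves. *)
  rewrite !mul1r mulrAC divff ?mul1r //.
  move: vz; rewrite (@valid_cat _ _ _ M lo mid hi) ?(ltnW lm) ?(ltnW mh) // => /andP [v1 v2].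
  by rewrite mulf_neq0 // pnatr_eq0 -lt0n (npaths_gt0 _ _ v1, npaths_gt0 _ _ v2) //; lia.
under eq_bigr => b _ do rewrite E.
rewrite (bigD1 (get z mid)) //= eqxx mul1r big1 ?addr0 // => b /negbTE ->.
by rewrite mul0r.
Qed.

Lemma OmegaE w : (w \in Omega M N) =
  [&& get w 0 \in init M, get w N \in target M & valid_path M 0 N w].
Proof.
by rewrite inE; do 2!congr (_ && _); apply: eq_forallb => j; rewrite ltn_ord.
Qed.

Hypotheses (n0 : (0 < n)%N) (hNn : N = (2 ^ n)%N).

Lemma inner_full : inord 0 |: (inord N |: inner 0 N) = [set: 'I_N.+1].
Proof.
apply/setP=> i; rewrite !inE -!val_eqE /= !inordK //.
by have := ltn_ord i; lia.
Qed.

(** Summing over the middle state gives the number of paths between [a] and [c]; summing over the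
    ends then counts all traces. *)
Lemma sum_weight : \sum_a \sum_c \sum_b triple_weight (n := n) M a b c = #|Omega M N|%:R :> R.
Proof.
have N0 : (0 < N)%N by rewrite hNn expn_gt0.
pose w0 : tseq k N := [ffun=> [ffun=> false]].
have -> : #|Omega M N|%:R = \sum_z (agree_off setT w0 z)%:R * (z \in Omega M N)%:R :> R.
  rewrite -sum1_card natr_sum big_mkcond /=; apply: eq_bigr => z _.
  have -> : agree_off setT w0 z by apply/agree_offP=> i; rewrite inE.
  by rewrite mul1r; case: (z \in _).
have d0 : [disjoint [set (inord 0 : 'I_N.+1)] & inord N |: inner 0 N].
  by rewrite disjoints1 !inE inord_eq // inordK //; lia.
have dN : [disjoint [set (inord N : 'I_N.+1)] & inner 0 N].
  by rewrite disjoints1 !inE inordK //; lia.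
rewrite -inner_full sum_agree_off_split // sum_agree_off_put; apply: eq_bigr => a _.
rewrite sum_agree_off_split // sum_agree_off_put; apply: eq_bigr => c _.
set w1 := put N c _.
have w10 : get w1 0 = a by rewrite get_put_neq ?get_put //; lia.
have w1N : get w1 N = c by rewrite get_put.
transitivity (np n a c * (c \in target M)%:R * (a \in init M)%:R).
  rewrite -(prednK n0) [npaths M n.-1.+1]/npaths -/npaths natr_sum -2!big_distrl /=; congr (_ * _ * _).
  by apply: eq_bigr => b _; rewrite natrM.
rewrite -w10 -w1N -(@sum_valid R _ _ _ M n 0 N) // -mulrA big_distrl /=.
apply: eq_bigr => z _; have [ag|_] := boolP (agree_off _ w1 z); last by rewrite !mul0r.
have -> : get w1 0 = get z 0 by apply: (get_agree ag); lia.
have -> : get w1 N = get z N by apply: (get_agree ag); lia.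
rewrite OmegaE !mul1r -!mulnb !natrM.
by ring.
Qed.

Lemma drawSampleE w : w \in Omega M N ->
  drawSample P N (makeADDs P M) w = (#|Omega M N|%:R)^-1.
Proof.
rewrite OmegaE => /and3P [wI wF wv].
have p2 : (0 < 2 ^ n.-1)%N by rewrite expn_gt0.
have e2 : N = (2 ^ n.-1 + 2 ^ n.-1)%N by rewrite addnn -mul2n -expnS prednK.
pose mid := (N %/ 2)%N; have emid : mid = (2 ^ n.-1)%N by rewrite /mid; lia.
rewrite /drawSample ffunE -/mid.
under eq_bigr => w1 _.
  rewrite (@rec_pairE n.-1 0 mid N) //; [|by apply: recE; lia|by lia].
  rewrite sampleFromADD_eq // add0n -/mid sum_weight.
over.
rewrite /=; set q := np n.-1 _ _ * np n.-1 _ _.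
have q0 : q != 0.
  move: wv; rewrite (@valid_cat _ _ _ M 0 mid N) //; last by lia.
  case/andP=> v1 v2; rewrite /q mulf_neq0 // pnatr_eq0 -lt0n.
    by apply: (npaths_gt0 _ _ v1); lia.
  by apply: (npaths_gt0 _ _ v2); lia.
(* Only the triple formed by the first, middle and last states of [w] survives, and its weight is
   [q]. *)
transitivity (\sum_a \sum_c \sum_b triple_weight (n := n) M a b c / #|Omega M N|%:R *
    ([&& c == get w N, b == get w mid & a == get w 0]%:R / q) : R).
  under eq_bigr => w1 _ do rewrite big_distrl /=.
  rewrite exchange_big; apply: eq_bigr => a _ /=.
  under eq_bigr => w1 _ do rewrite big_distrl /=.
  rewrite exchange_big; apply: eq_bigr => c _ /=.
  under eq_bigr => w1 _ do rewrite big_distrl /=.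
  rewrite exchange_big; apply: eq_bigr => b _ /=.
  set w2 := put N c _; rewrite (bigD1 w2) //= eqxx mulr1 big1 ?addr0; last first.
    by move=> w1 /negbTE ->; rewrite mulr0 mul0r.
  congr (_ * ((nat_of_bool _)%:R / _)).
  rewrite /w2 agree_off_put; last by rewrite !inE inordK //; lia.
  rewrite agree_off_put; last by rewrite !inE inord_eq ?inordK //; lia.
  rewrite agree_off_put; last by rewrite !inE !inord_eq ?inordK //; lia.
  (* These sets cover all positions, so the initial array imposes no condition. *)
  have -> : agree_off (inord 0 |: (inord mid |: (inord N |: (inner 0 mid :|: inner mid N))))
      [ffun=> [ffun=> false]] w.
    apply/agree_offP=> i; rewrite !inE -!val_eqE /= !inordK //; last by lia.
    by have := ltn_ord i; lia.
  by rewrite andTb andbC [X in _ && X]andbC.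
rewrite (bigD1 (get w 0)) //= [X in _ + X]big1 ?addr0 => [|a /negbTE na]; last first.
  by rewrite big1 // => c _; rewrite big1 // => b _; rewrite na !andbF mul0r mulr0.
rewrite (bigD1 (get w N)) //= [X in _ + X]big1 ?addr0 => [|c /negbTE nc]; last first.
  by rewrite big1 // => b _; rewrite nc mul0r mulr0.
rewrite (bigD1 (get w mid)) //= [X in _ + X]big1 ?addr0 => [|b /negbTE nb]; last first.
  by rewrite nb andbF mul0r mulr0.
by rewrite !eqxx /triple_weight wI wF !mulr1 -/q mul1r mulrAC divff // mul1r.
Qed.

End Uniformity.

Theorem theorem6p6 (R : realType) (k m : nat) (M : tsystem k m)
    (N n : nat) (hN : (2 <= N)%N) (hNn : N = (2 ^ n)%N)
    (le : rel (xvar k n)) (le_total : total le) (le_trans : transitive le)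
    (le_anti : antisymmetric le)
    (P : add_package R le) (w : tseq k N) (hw : w \in Omega M N) :
  drawSample P N (makeADDs P M) w = (#|Omega M N|%:R)^-1.
Proof.
have n0 : (0 < n)%N by rewrite -(@ltn_exp2l 2) // expn0 -hNn.
exact: (drawSampleE P n0 hNn hw).
Qed.
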